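(* Let $|q|<1$ and let $A,B,C,D$ be parameters. Then $$\sum_{i,j,k,l\ge 0}A^iB^jC^kD^l\sum \frac{q^{T_\tau+T_{ab}+T_{ac}+T_{ad}+T_{bc}+T_{bd}+T_{cd}-bc-bd-cd+4T_{Q-1}+3Q+2Q\tau}}{(q)_a(q)_b(q)_c(q)_d(q)_{ab}(q)_{ac}(q)_{ad}(q)_{bc}(q)_{bd}(q)_{cd}(q)_Q}\cdot\left\{(1-q^a)+q^{a+bc+bd+Q}(1-q^b)+q^{a+bc+bd+Q+b+cd}\right\}$$ $$=(-Aq)_\infty(-Bq)_\infty(-Cq)_\infty(-Dq)_\infty,$$ where, for each $(i,j,k,l)$, the inner (finite) sum is over all nonnegative integers $a,b,c,d,ab,ac,ad,bc,bd,cd,Q$ satisfying $$\begin{cases} i=a+ab+ac+ad+Q,\\ j=b+ab+bc+bd+Q,\\ k=c+ac+bc+cd+Q,\\ l=d+ad+bd+cd+Q,\end{cases}$$ and $\tau=a+b+c+d+ab+ac+ad+bc+bd+cd$.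
   Context: Here $ab,ac,ad,bc,bd,cd$ are names of independent summation variables; $ab$ does not denote the product of $a$ and $b$, and similarly for $ac,ad,bc,bd,cd$. $T_n=\frac{n(n+1)}{2}$ for every integer $n$ (so $T_{-1}=0$). For an integer $n\ge0$, $(x)_n=(x;q)_n=\prod_{j=0}^{n-1}(1-xq^j)$ (with $(x)_0=1$), and $(x)_\infty=\lim_{n\to\infty}(x)_n$. In particular $(q)_n=\prod_{j=1}^{n}(1-q^j)$. *)

(* Defs.v *)
From HB Require Import structures.
From mathcomp Require Import all_boot all_order all_algebra complex.
From mathcomp Require Import all_classical all_reals all_analysis.
From mathcomp Require Export showcase.summability.

Set Implicit Arguments.
Unset Strict Implicit.
Unset Printing Implicit Defensive.

Import Order.TTheory GRing.Theory Num.Theory.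
Import numFieldNormedType.Exports.

Local Open Scope classical_set_scope.
Local Open Scope ring_scope.

Definition qpoch (K : comNzRingType) (q x : K) (n : nat) : K :=
  \prod_(0 <= j < n) (1 - x * q ^+ j).

(* The regular algebra R[i]^o is the copy of R[i] that carries the topology of
   the modulus. *)
Definition qpoch_inf (R : realType) (q x : R[i]) : R[i] :=
  lim ((qpoch q x n : R[i]^o) @[n --> \oo]).

(* Triangular numbers, at all integers; the division is exact. *)
Definition T (n : int) : int := ((n * (n + 1)) %/ 2)%Z.

Section Summand.
Variable K : fieldType.
Variable q : K.

(* The exponent of q is computed in int, so the subtractions are not truncated.
   It is nonnegative whenever the indices are, since T n - n = T (n - 1). *)
Definition qexponent (a b c d ab ac ad bc bd cd Q : int) : int :=
  let tau := a + b + c + d + ab + ac + ad + bc + bd + cd in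
  T tau + T ab + T ac + T ad + T bc + T bd + T cd - bc - bd - cd
  + 4 * T (Q - 1) + 3 * Q + 2 * Q * tau.

Definition summand (a b c d ab ac ad bc bd cd Q : nat) : K :=
  q ^ qexponent a b c d ab ac ad bc bd cd Q
  / (qpoch q q a * qpoch q q b * qpoch q q c * qpoch q q d
     * qpoch q q ab * qpoch q q ac * qpoch q q ad
     * qpoch q q bc * qpoch q q bd * qpoch q q cd * qpoch q q Q)
  * ((1 - q ^+ a)
     + q ^+ (a + bc + bd + Q) * (1 - q ^+ b)
     + q ^+ (a + bc + bd + Q + b + cd)).

(* The constraints bound every index by one of i, j, k, l, so cutting all the
   ranges at i + j + k + l loses no solution. *)
Definition inner_sum (i j k l : nat) : K :=
  let N := (i + j + k + l).+1 in
  \sum_(0 <= a < N) \sum_(0 <= b < N) \sum_(0 <= c < N) \sum_(0 <= d < N)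
  \sum_(0 <= ab < N) \sum_(0 <= ac < N) \sum_(0 <= ad < N)
  \sum_(0 <= bc < N) \sum_(0 <= bd < N) \sum_(0 <= cd < N)
  \sum_(0 <= Q < N | [&& i == (a + ab + ac + ad + Q)%N,
                         j == (b + ab + bc + bd + Q)%N,
                         k == (c + ac + bc + cd + Q)%N
                       & l == (d + ad + bd + cd + Q)%N])
    summand a b c d ab ac ad bc bd cd Q.

End Summand.

(* Unconditional summation: the sums over finite sets of indices converge to s
   along the finite sets ordered by inclusion. *)
Definition has_sum (I : choiceType) (R : realType) (f : I -> R[i]) (s : R[i]) :
  Prop := partial_sum (f : I -> R[i]^o) @ totally --> (s : R[i]^o).

(* Main.v *)
(**
   Since T_tau + 4 T_(Q-1) + 3 Q + 2 Q tau = T_(tau + 2 Q), a variable x marking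
   tau + 2 Q uncouples the indices. Let L be the linear functional
   x^n |-> q^(T_n), and

     V = (-qxAB, -qxAC, -qxAD, -qxBC, -qxBD, -qxCD)_oo
         / ((xA, xB, xC, xD)_oo (x^2 ABCD)_oo).

   The bracket acts on V by q-shifts, and the generating function of the inner
   sums turns out to be L (V g), with a factor g symmetric in A, B, C, D
   ([symfactor]).
   As L (x p(x)) = q L (p(qx)), a combination of the form x p(x) - q p(qx) is
   killed by L. With p = A (1 + xBC) (1 + xBD) (1 + xCD) V this gives

     L (V g) (A) = (1 + qA) L (V g) (qA),

   that is, (1 - q^i) S(i,j,k,l) = q^i S(i-1,j,k,l) for the inner sums S, and
   likewise in the other indices. Hence S(i,j,k,l) is the product of the
   q^(T_n) / (q)_n for n = i, j, k, l, and Euler's expansion of (-aq)_oo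
   concludes.
*)
Require Import Defs.
From HB Require Import structures.
From mathcomp Require Import all_boot all_order all_algebra complex.
From mathcomp Require Import all_classical all_reals all_analysis.
From mathcomp Require Import finmap ring lra zify.

Set Implicit Arguments.
Unset Strict Implicit.
Unset Printing Implicit Defensive.

Import Order.TTheory GRing.Theory Num.Theory.
Import numFieldNormedType.Exports.
Local Open Scope ring_scope.

(** * Truncated series and the telescoping certificate *)

Section TruncatedSeries.
Variables (R : comNzRingType) (I : R -> Prop).
Hypothesis ideal0 : I 0.
Hypothesis idealD : forall x y, I x -> I y -> I (x + y).
Hypothesis idealM : forall x y, I y -> I (x * y).

(** Congruence modulo the ideal [I]. Power series are replaced by polynomials modulo high powers of
    the variables, so every infinite product identity becomes a congruence. *)
Definition eqI (x y : R) := I (x - y).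

Lemma idealN x : I x -> I (- x).
Proof. by rewrite -mulN1r; apply: idealM. Qed.

Lemma eqI_refl x : eqI x x.
Proof. by rewrite /eqI subrr. Qed.

Lemma eqI_eq x y : x = y -> eqI x y.
Proof. by move=> ->; apply: eqI_refl. Qed.

Lemma eqI_sym x y : eqI x y -> eqI y x.
Proof. by move=> /idealN; rewrite opprB. Qed.

Lemma eqI_trans y x z : eqI x y -> eqI y z -> eqI x z.
Proof. by move=> xy yz; have := idealD xy yz; rewrite subrKA. Qed.

Lemma eqID x y z t : eqI x y -> eqI z t -> eqI (x + z) (y + t).
Proof. by move=> xy zt; have := idealD xy zt; rewrite addrACA -opprD. Qed.

Lemma eqIN x y : eqI x y -> eqI (- x) (- y).
Proof. by move=> /idealN; rewrite /eqI opprB opprK addrC. Qed.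

Lemma eqIB x y z t : eqI x y -> eqI z t -> eqI (x - z) (y - t).
Proof. by move=> xy zt; apply: eqID => //; apply: eqIN. Qed.

Lemma eqIM x y z t : eqI x y -> eqI z t -> eqI (x * z) (y * t).
Proof.
move=> /(idealM z) xy /(idealM y) zt; have := idealD xy zt.
by rewrite /eqI; congr I; ring.
Qed.

Variables (q : R) (c : nat -> R) (N : nat).
Hypothesis cS : forall n, c n.+1 * (1 - q ^+ n.+1) = c n.

(* For [c n] = 1 / (q)_n these are 1 / (z)_oo and (-z)_oo, up to [z ^+ N.+1]. *)
Definition eser (z : R) := \sum_(0 <= n < N.+1) c n * z ^+ n.
Definition Eser (z : R) := \sum_(0 <= n < N.+1) q ^+ 'C(n, 2) * c n * z ^+ n.

(** The condition on an argument under which truncating at degree [N] costs nothing modulo [I]. *)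
Definition small (z : R) := I (z ^+ N.+1).

Lemma smallM x y : small y -> small (x * y).
Proof. by rewrite /small exprMn; apply: idealM. Qed.

(** Truncated form of 1 / (qz)_oo = (1 - z) / (z)_oo. By [cS] the coefficients telescope, and only
    the boundary term [c N * z ^+ N.+1] is left over. *)
Lemma eser_scale z : small z -> eqI (eser (q * z)) ((1 - z) * eser z).
Proof.
move=> zN; rewrite /eqI.
suff -> : eser (q * z) - (1 - z) * eser z = c N * z ^+ N.+1 by exact: idealM.
have -> : eser (q * z) = eser z - z * \sum_(0 <= n < N) c n * z ^+ n.
  apply/eqP; rewrite eq_sym subr_eq addrC -subr_eq; apply/eqP.
  rewrite /eser -sumrB big_nat_recl // !expr0 subrr add0r big_distrr /=.
  by apply: eq_bigr => n _; rewrite -(cS n) exprMn !exprS; ring.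
by rewrite /eser big_nat_recr //= exprS; ring.
Qed.

(** Truncated form of (-z)_oo = (1 + z) (-qz)_oo, again up to one boundary term of degree [N.+1]. *)
Lemma Eser_scale z : small z -> eqI (Eser z) ((1 + z) * Eser (q * z)).
Proof.
move=> zN; rewrite /eqI.
have EN : Eser (q * z) = \sum_(0 <= n < N) q ^+ 'C(n.+1, 2) * c n * z ^+ n
            + q ^+ 'C(N.+1, 2) * c N * z ^+ N.
  rewrite -big_nat_recr //=; apply: eq_bigr => n _.
  by rewrite exprMn binS bin1 exprD; ring.
suff -> : Eser z - (1 + z) * Eser (q * z)
          = - (q ^+ 'C(N.+1, 2) * c N) * z ^+ N.+1 by exact: idealM.
have -> : Eser z = Eser (q * z)
                   + z * \sum_(0 <= n < N) q ^+ 'C(n.+1, 2) * c n * z ^+ n.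
  rewrite addrC; apply/eqP; rewrite -subr_eq; apply/eqP.
  rewrite /Eser -sumrB big_nat_recl // !expr0 subrr add0r big_distrr /=.
  apply: eq_bigr => n _.
  by rewrite -(cS n) exprMn binS bin1 exprD !exprS; ring.
by rewrite EN exprS; ring.
Qed.

Section Product.
Variables A B C D x : R.

(** The truncation of the product V: [eser] supplies its denominators, [Eser] its numerators. *)
Definition quadprod :=
  eser (x * A) * eser (x * B) * eser (x * C) * eser (x * D)
  * (Eser (q * (x * A * B)) * Eser (q * (x * A * C)) * Eser (q * (x * A * D)))
  * (Eser (q * (x * B * C)) * Eser (q * (x * B * D)) * Eser (q * (x * C * D)))
  * eser (x ^+ 2 * (A * B * C * D)).

Definition symfactor :=
  1 + x ^+ 2 * (A * B * C + A * B * D + A * C * D + B * C * D - A * B * C * D)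
  + x ^+ 3 * (A * B * C * D) * (A + B + C + D - 1)
  + x ^+ 5 * (A * B * C * D) ^+ 2.

(* The generating function of [summand], with [x] marking tau + 2 Q. *)
Definition bracketed :=
  (eser (x * A) - eser (q * (x * A))) * eser (x * B) * eser (x * C)
    * eser (x * D)
    * (Eser (q * (x * A * B)) * Eser (q * (x * A * C)) * Eser (q * (x * A * D)))
    * (Eser (x * B * C) * Eser (x * B * D) * Eser (x * C * D))
    * eser (x ^+ 2 * (A * B * C * D))
  + eser (q * (x * A)) * (eser (x * B) - eser (q * (x * B))) * eser (x * C)
    * eser (x * D)
    * (Eser (q * (x * A * B)) * Eser (q * (x * A * C)) * Eser (q * (x * A * D)))
    * (Eser (q * (x * B * C)) * Eser (q * (x * B * D)) * Eser (x * C * D))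
    * eser (q * (x ^+ 2 * (A * B * C * D)))
  + eser (q * (x * A)) * eser (q * (x * B)) * eser (x * C)
    * eser (x * D)
    * (Eser (q * (x * A * B)) * Eser (q * (x * A * C)) * Eser (q * (x * A * D)))
    * (Eser (q * (x * B * C)) * Eser (q * (x * B * D)) * Eser (q * (x * C * D)))
    * eser (q * (x ^+ 2 * (A * B * C * D))).

End Product.

Ltac eqI_solve := repeat first [apply: eqIM | apply: eqID | apply: eqIN
  | apply: eser_scale | apply: Eser_scale | exact: eqI_refl].

(** Undoing all q-shifts leaves V times xA (1 + xBC) (1 + xBD) (1 + xCD) + (1 - xA) xB (1 + xCD) (1
    - Z) + (1 - xA) (1 - xB) (1 - Z), where Z = x^2 ABCD. This expands to the symmetric
    [symfactor]. *)
Lemma bracketedE A B C D x : small A -> small B -> small C -> small D ->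
  eqI (bracketed A B C D x) (quadprod A B C D x * symfactor A B C D x).
Proof.
move=> sA sB sC sD; rewrite /bracketed.
set eB := eser (x * B); set eC := eser (x * C); set eD := eser (x * D).
set E3 := Eser (q * (x * A * B)) * Eser (q * (x * A * C)) * _.
apply: (@eqI_trans (
  (eser (x * A) - (1 - x * A) * eser (x * A)) * eB * eC * eD * E3
    * ((1 + x * B * C) * Eser (q * (x * B * C))
       * ((1 + x * B * D) * Eser (q * (x * B * D)))
       * ((1 + x * C * D) * Eser (q * (x * C * D))))
    * eser (x ^+ 2 * (A * B * C * D))
  + (1 - x * A) * eser (x * A) * (eB - (1 - x * B) * eB) * eC * eD * E3
    * (Eser (q * (x * B * C)) * Eser (q * (x * B * D))
       * ((1 + x * C * D) * Eser (q * (x * C * D))))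
    * ((1 - x ^+ 2 * (A * B * C * D)) * eser (x ^+ 2 * (A * B * C * D)))
  + (1 - x * A) * eser (x * A) * ((1 - x * B) * eB) * eC * eD * E3
    * (Eser (q * (x * B * C)) * Eser (q * (x * B * D))
       * Eser (q * (x * C * D)))
    * ((1 - x ^+ 2 * (A * B * C * D)) * eser (x ^+ 2 * (A * B * C * D))))).
  by rewrite /eB; eqI_solve; rewrite ?mulrA; apply: smallM.
rewrite /quadprod -/eB -/eC -/eD -/E3 /symfactor.
by apply: eqI_eq; ring.
Qed.

Definition telescoper A B C D x :=
  A * ((1 + x * B * C) * (1 + x * B * D) * (1 + x * C * D))
  * quadprod A B C D x.

(* Every value of [quadprod] involved is a polynomial multiple of one product
   [M], so that the statement reduces to a polynomial identity. *)
Lemma quadprod_telescopes A B C D x :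
  small A -> small B -> small C -> small D ->
  eqI (quadprod A B C D x * symfactor A B C D x
       - (1 + q * A) * (quadprod (q * A) B C D x * symfactor (q * A) B C D x))
      (x * telescoper A B C D x - q * telescoper A B C D (q * x)).
Proof.
move=> sA sB sC sD.
pose Z := x ^+ 2 * (A * B * C * D).
(* The numerators containing [A] are taken with the shift q^2, which both A -> qA and x -> qx
   produce; [P] is the correction at the unshifted point. *)
pose M := eser (x * A) * eser (x * B) * eser (x * C) * eser (x * D)
  * (Eser (q * (q * (x * A * B))) * Eser (q * (q * (x * A * C)))
     * Eser (q * (q * (x * A * D))))
  * (Eser (q * (x * B * C)) * Eser (q * (x * B * D)) * Eser (q * (x * C * D)))
  * eser Z.
pose P := (1 + q * (x * A * B)) * (1 + q * (x * A * C)) * (1 + q * (x * A * D)).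
have sZ : small Z by rewrite /Z !mulrA; apply: smallM.
have quadprod_x : eqI (quadprod A B C D x) (P * M).
  apply: (@eqI_trans (eser (x * A) * eser (x * B) * eser (x * C) * eser (x * D)
    * (((1 + q * (x * A * B)) * Eser (q * (q * (x * A * B))))
       * ((1 + q * (x * A * C)) * Eser (q * (q * (x * A * C))))
       * ((1 + q * (x * A * D)) * Eser (q * (q * (x * A * D)))))
    * (Eser (q * (x * B * C)) * Eser (q * (x * B * D))
       * Eser (q * (x * C * D))) * eser Z)).
    by rewrite /quadprod; eqI_solve; rewrite ?mulrA; apply: smallM.
  by apply: eqI_eq; rewrite /M /P; ring.
have quadprod_qA : eqI (quadprod (q * A) B C D x)
    ((1 - x * A) * (1 - Z) * M).
  have -> : quadprod (q * A) B C D x =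
    eser (q * (x * A)) * eser (x * B) * eser (x * C) * eser (x * D)
    * (Eser (q * (q * (x * A * B))) * Eser (q * (q * (x * A * C)))
     * Eser (q * (q * (x * A * D))))
    * (Eser (q * (x * B * C)) * Eser (q * (x * B * D))
       * Eser (q * (x * C * D))) * eser (q * Z).
    by rewrite /quadprod /Z; do ![congr (_ * _)]; congr (_ _); ring.
  apply: (@eqI_trans (
    (1 - x * A) * eser (x * A) * eser (x * B) * eser (x * C) * eser (x * D)
    * (Eser (q * (q * (x * A * B))) * Eser (q * (q * (x * A * C)))
     * Eser (q * (q * (x * A * D))))
    * (Eser (q * (x * B * C)) * Eser (q * (x * B * D))
       * Eser (q * (x * C * D))) * ((1 - Z) * eser Z))).
    by eqI_solve; rewrite ?mulrA //; apply: smallM.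
  by apply: eqI_eq; rewrite /M; ring.
(* The three cofactors of [telescoper] at qx absorb one q-shift of the BC, BD and CD numerators,
   which brings them back to those of [M]. *)
have quadprod_qx : eqI ((1 + q * x * B * C) * (1 + q * x * B * D)
                        * (1 + q * x * C * D) * quadprod A B C D (q * x))
    ((1 - x * A) * (1 - x * B) * (1 - x * C) * (1 - x * D)
     * (1 - Z) * (1 - q * Z) * M).
  have -> : quadprod A B C D (q * x) =
    eser (q * (x * A)) * eser (q * (x * B)) * eser (q * (x * C))
    * eser (q * (x * D))
    * (Eser (q * (q * (x * A * B))) * Eser (q * (q * (x * A * C)))
     * Eser (q * (q * (x * A * D))))
    * (Eser (q * (q * (x * B * C))) * Eser (q * (q * (x * B * D)))
       * Eser (q * (q * (x * C * D)))) * eser (q * (q * Z)).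
    by rewrite /quadprod /Z; do ![congr (_ * _)]; congr (_ _); ring.
  (* [Z] is quadratic in [x], so x -> qx shifts it twice. *)
  have e2 : eqI (eser (q * (q * Z))) ((1 - q * Z) * ((1 - Z) * eser Z)).
    apply: (@eqI_trans ((1 - q * Z) * eser (q * Z))).
      by apply: eser_scale; apply: smallM.
    by apply: eqIM; [exact: eqI_refl | exact: eser_scale].
  apply: (@eqI_trans ((1 + q * x * B * C) * (1 + q * x * B * D)
                        * (1 + q * x * C * D) * (
    (1 - x * A) * eser (x * A) * ((1 - x * B) * eser (x * B))
    * ((1 - x * C) * eser (x * C)) * ((1 - x * D) * eser (x * D))
    * (Eser (q * (q * (x * A * B))) * Eser (q * (q * (x * A * C)))
     * Eser (q * (q * (x * A * D))))
    * (Eser (q * (q * (x * B * C))) * Eser (q * (q * (x * B * D)))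
       * Eser (q * (q * (x * C * D))))
    * ((1 - q * Z) * ((1 - Z) * eser Z))))).
    by apply: eqIM; [exact: eqI_refl | apply: eqIM e2];
      eqI_solve; apply: smallM.
  apply: (@eqI_trans (
    (1 - x * A) * eser (x * A) * ((1 - x * B) * eser (x * B))
    * ((1 - x * C) * eser (x * C)) * ((1 - x * D) * eser (x * D))
    * (Eser (q * (q * (x * A * B))) * Eser (q * (q * (x * A * C)))
     * Eser (q * (q * (x * A * D))))
    * (((1 + q * (x * B * C)) * Eser (q * (q * (x * B * C))))
       * ((1 + q * (x * B * D)) * Eser (q * (q * (x * B * D))))
       * ((1 + q * (x * C * D)) * Eser (q * (q * (x * C * D)))))
    * ((1 - q * Z) * ((1 - Z) * eser Z)))).
    by apply: eqI_eq; ring.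
  apply: (@eqI_trans (
    (1 - x * A) * eser (x * A) * ((1 - x * B) * eser (x * B))
    * ((1 - x * C) * eser (x * C)) * ((1 - x * D) * eser (x * D))
    * (Eser (q * (q * (x * A * B))) * Eser (q * (q * (x * A * C)))
     * Eser (q * (q * (x * A * D))))
    * (Eser (q * (x * B * C)) * Eser (q * (x * B * D)) * Eser (q * (x * C * D)))
    * ((1 - q * Z) * ((1 - Z) * eser Z)))).
    apply: eqIM (eqI_refl _); apply: eqIM; first exact: eqI_refl.
    by apply: eqIM; [apply: eqIM|]; apply: eqI_sym; apply: Eser_scale;
      rewrite !mulrA; apply: smallM.
  by apply: eqI_eq; rewrite /M; ring.
apply: (@eqI_trans (P * M * symfactor A B C D x - (1 + q * A)
   * ((1 - x * A) * (1 - Z) * M * symfactor (q * A) B C D x))).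
  apply: eqIB; first by apply: eqIM (eqI_refl _).
  by apply: eqIM (eqI_refl _) _; apply: eqIM (eqI_refl _).
apply: eqI_sym.
apply: (@eqI_trans (x * (A * ((1 + x * B * C) * (1 + x * B * D)
  * (1 + x * C * D)) * (P * M)) - q * (A * ((1 - x * A) * (1 - x * B)
     * (1 - x * C) * (1 - x * D) * (1 - Z) * (1 - q * Z) * M)))).
  apply: eqIB; apply: eqIM; try exact: eqI_refl; rewrite /telescoper.
    by apply: eqIM; [exact: eqI_refl|].
  by rewrite -[A * _ * _]mulrA; apply: eqIM; [exact: eqI_refl|].
(* Both sides are now multiples of [M], and the cofactors satisfy an exact polynomial identity. *)
rewrite /P /Z /symfactor.
by apply: eqI_eq; ring.
Qed.

End TruncatedSeries.

(** * Substitutions in the product and its symmetry *)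

Section Morphism.
Variables (R : comNzRingType) (q : R) (c : nat -> R) (N : nat).
Variable phi : {rmorphism R -> R}.
Hypothesis phi_q : phi q = q.
Hypothesis phi_c : forall n, phi (c n) = c n.

Lemma rmorph_eser z : phi (eser c N z) = eser c N (phi z).
Proof.
by rewrite rmorph_sum; apply: eq_bigr => n _; rewrite rmorphM rmorphXn /= phi_c.
Qed.

Lemma rmorph_Eser z : phi (Eser q c N z) = Eser q c N (phi z).
Proof.
rewrite rmorph_sum; apply: eq_bigr => n _.
by rewrite !rmorphM !rmorphXn /= phi_q phi_c.
Qed.

Lemma rmorph_quadprod A B C D x : phi (quadprod q c N A B C D x)
  = quadprod q c N (phi A) (phi B) (phi C) (phi D) (phi x).
Proof.
rewrite /quadprod !(rmorphM phi) !rmorph_eser !rmorph_Eser.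
by rewrite !(rmorphXn phi, rmorphM phi) phi_q.
Qed.

Lemma rmorph_symfactor A B C D x : phi (symfactor A B C D x)
  = symfactor (phi A) (phi B) (phi C) (phi D) (phi x).
Proof.
by rewrite /symfactor !(rmorphXn phi, rmorphB phi, rmorphD phi, rmorph1 phi,
  rmorphM phi).
Qed.

Lemma rmorph_telescoper A B C D x : phi (telescoper q c N A B C D x)
  = telescoper q c N (phi A) (phi B) (phi C) (phi D) (phi x).
Proof.
rewrite /telescoper (rmorphM phi) rmorph_quadprod.
by rewrite !(rmorphD phi, rmorphM phi, rmorph1 phi).
Qed.

End Morphism.

Section Symmetry.
Variables (R : comNzRingType) (q : R) (c : nat -> R) (N : nat).

(** The product V g. Its symmetry lets the functional equation in the first variable serve all
    four. *)
Definition symquad A B C D x :=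
  quadprod q c N A B C D x * symfactor A B C D x.

Lemma symquadAB A B C D x : symquad A B C D x = symquad B A C D x.
Proof.
(* The values of [eser] and [Eser] are atoms for [ring], so their arguments are first made to
   agree. *)
rewrite /symquad /quadprod (mulrAC x B A) /symfactor.
have -> : x ^+ 2 * (B * A * C * D) = x ^+ 2 * (A * B * C * D) by ring.
ring.
Qed.

Lemma symquadBC A B C D x : symquad A B C D x = symquad A C B D x.
Proof.
rewrite /symquad /quadprod (mulrAC x C B) /symfactor.
have -> : x ^+ 2 * (A * C * B * D) = x ^+ 2 * (A * B * C * D) by ring.
ring.
Qed.

Lemma symquadCD A B C D x : symquad A B C D x = symquad A B D C x.
Proof.
rewrite /symquad /quadprod (mulrAC x D C) /symfactor.
have -> : x ^+ 2 * (A * B * D * C) = x ^+ 2 * (A * B * C * D) by ring.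
ring.
Qed.

Lemma symquadAC A B C D x : symquad A B C D x = symquad C A B D x.
Proof. by rewrite symquadBC symquadAB. Qed.

Lemma symquadAD A B C D x : symquad A B C D x = symquad D A B C x.
Proof. by rewrite symquadCD symquadAC. Qed.

End Symmetry.

(** * The triangular functional on polynomials *)

Lemma coef_scale (R : comNzRingType) (a : R) (p : {poly R}) n :
  (p \Po (a *: 'X))`_n = a ^+ n * p`_n.
Proof.
rewrite coef_comp_poly; under eq_bigr => i _ do rewrite exprZn coefZ coefXn.
case: (ltnP n (size p)) => [n_lt|n_ge].
  rewrite (bigD1 (Ordinal n_lt)) //= eqxx mulr1 mulrC big1 ?addr0 // => i.
  by rewrite -val_eqE eq_sym /= => /negPf->; rewrite !mulr0.
rewrite nth_default // mulr0 big1 // => i _.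
by rewrite gtn_eqF ?mulr0 // (leq_trans _ n_ge).
Qed.

Section TriangularFunctional.
Variables (K : fieldType) (q : K).

(** The functional L: the binomial ['C(n.+1, 2)] is T_n. *)
Definition trisum (p : {poly K}) : K :=
  \sum_(0 <= n < size p) p`_n * q ^+ 'C(n.+1, 2).

Lemma trisum_widen m (p : {poly K}) : (size p <= m)%N ->
  trisum p = \sum_(0 <= n < m) p`_n * q ^+ 'C(n.+1, 2).
Proof.
move=> pm; rewrite (big_cat_nat _ pm) //= [X in _ + X]big_nat_cond.
rewrite [X in _ + X]big1 ?addr0 // => n /andP[/andP[+ _] _] => pn.
by rewrite nth_default // mul0r.
Qed.

Lemma trisumD p r : trisum (p + r) = trisum p + trisum r.
Proof.
rewrite (trisum_widen (size_polyD p r)) (trisum_widen (leq_maxl _ (size r))).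
rewrite (trisum_widen (leq_maxr (size p) _)) -big_split /=.
by apply: eq_bigr => n _; rewrite coefD mulrDl.
Qed.

Lemma trisumZ a p : trisum (a%:P * p) = a * trisum p.
Proof.
have := size_polyMleq a%:P p; rewrite size_polyC => s.
have {}s : (size (a%:P * p)%R <= size p)%N.
  by apply: leq_trans s _; case: (a != 0); rewrite // add0n leq_pred.
rewrite (trisum_widen s) /trisum mulr_sumr; apply: eq_bigr => n _.
by rewrite coefCM mulrA.
Qed.

Lemma trisumXn n : trisum 'X^n = q ^+ 'C(n.+1, 2).
Proof.
rewrite (@trisum_widen n.+1) ?size_polyXn // big_nat_recr //= coefXn eqxx mul1r.
rewrite big_nat_cond big1 ?add0r // => m /andP[/andP[_ mn] _].
by rewrite coefXn ltn_eqF // mul0r.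
Qed.

(** Since T_(n+1) = T_n + n + 1, raising the degree by one costs q times q^n, and q^n is the effect
    of x -> qx. This is what makes L kill x p(x) - q p(qx). *)
Lemma trisumX p : trisum ('X * p) = q * trisum (p \Po (q *: 'X)).
Proof.
have s : (size ('X * p)%R <= (size p).+1)%N.
  by rewrite (leq_trans (size_polyMleq _ _)) // size_polyX.
rewrite (trisum_widen s) big_nat_recl // coefXM mul0r add0r.
have s2 : (size (p \Po (q *: 'X))%R <= size p)%N.
  by apply/leq_sizeP => n pn; rewrite coef_scale nth_default // mulr0.
rewrite (trisum_widen s2) mulr_sumr; apply: eq_bigr => n _.
by rewrite coefXM /= coef_scale binS bin1 exprD exprS; ring.
Qed.

End TriangularFunctional.

(** * Expansion of the generating function *)

Section QuadSum.
Variables (K : fieldType) (N i j k l : nat).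

(** [inner_sum] with the summand and the range [N] left free, so that the three terms of the bracket
    can be expanded separately. *)
Definition quadsum
    (F : nat -> nat -> nat -> nat -> nat -> nat -> nat -> nat -> nat -> nat
         -> nat -> K) : K :=
  \sum_(0 <= a < N) \sum_(0 <= b < N) \sum_(0 <= c < N) \sum_(0 <= d < N)
  \sum_(0 <= ab < N) \sum_(0 <= ac < N) \sum_(0 <= ad < N)
  \sum_(0 <= bc < N) \sum_(0 <= bd < N) \sum_(0 <= cd < N)
  \sum_(0 <= Q < N | [&& i == (a + ab + ac + ad + Q)%N,
                         j == (b + ab + bc + bd + Q)%N,
                         k == (c + ac + bc + cd + Q)%N
                       & l == (d + ad + bd + cd + Q)%N])
    F a b c d ab ac ad bc bd cd Q.

Lemma eq_quadsum F G :
  (forall a b c d ab ac ad bc bd cd Q,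
    F a b c d ab ac ad bc bd cd Q = G a b c d ab ac ad bc bd cd Q) ->
  quadsum F = quadsum G.
Proof. by move=> FG; rewrite /quadsum; do 11!apply: eq_bigr => ? _. Qed.

Lemma quadsumD F G : quadsum F + quadsum G =
  quadsum (fun a b c d ab ac ad bc bd cd Q =>
    F a b c d ab ac ad bc bd cd Q + G a b c d ab ac ad bc bd cd Q).
Proof.
rewrite /quadsum; do 10!(rewrite -big_split; apply: eq_bigr => ? _).
by rewrite -big_split.
Qed.

End QuadSum.

Section Expansion.
Variables (K : fieldType) (q : K).
Variables (R : comNzRingType) (emb : {rmorphism K -> R}) (A B C D x : R).
(* [co i j k l] stands for the coefficient of [A^i B^j C^k D^l], followed by
   [trisum] in [x]. *)
Variable co : nat -> nat -> nat -> nat -> R -> K.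
Hypothesis coD : forall i j k l f g,
  co i j k l (f + g) = co i j k l f + co i j k l g.
Hypothesis coZ : forall i j k l a f, co i j k l (emb a * f) = a * co i j k l f.
Hypothesis co_mono : forall i j k l i' j' k' l' n,
  co i j k l (A ^+ i' * (B ^+ j' * (C ^+ k' * (D ^+ l' * x ^+ n))))
  = if [&& i == i', j == j', k == k' & l == l'] then q ^+ 'C(n.+1, 2) else 0.
Variable N : nat.

(** The common shape of [eser], [Eser] and their q-shifts, so that one expansion covers every term
    of [bracketed]. *)
Definition ser (f : nat -> K) (z : R) := \sum_(0 <= n < N) emb (f n) * z ^+ n.

Lemma co_sum i j k l n (F : nat -> R) :
  co i j k l (\sum_(0 <= m < n) F m) = \sum_(0 <= m < n) co i j k l (F m).
Proof.
apply: big_morph; first exact: coD.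
by rewrite -[0 in LHS](mul0r 0) -(rmorph0 emb) coZ mul0r.
Qed.

(** Opens one series inside a product nested to the right; [u] accumulates the monomials already
    chosen. *)
Lemma co_ser i j k l u f z v :
  co i j k l (u * (ser f z * v))
  = \sum_(0 <= n < N) co i j k l (u * (emb (f n) * z ^+ n) * v).
Proof.
rewrite /ser mulrA mulr_sumr mulr_suml co_sum.
by apply: eq_bigr => n _; rewrite mulrA.
Qed.

(** One monomial from each of the eleven series gives [A] the exponent a + ab + ac + ad + Q,
    likewise for [B], [C], [D], and gives [x] the exponent tau + 2 Q. The test in [co_mono] is then
    the filter of [quadsum]. *)
Lemma co_prod i j k l fa fb fc fd fab fac fad fbc fbd fcd fQ :
  co i j k l (ser fa (x * A) * ser fb (x * B) * ser fc (x * C) * ser fd (x * D)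
    * (ser fab (x * A * B) * ser fac (x * A * C) * ser fad (x * A * D))
    * (ser fbc (x * B * C) * ser fbd (x * B * D) * ser fcd (x * C * D))
    * ser fQ (x ^+ 2 * (A * B * C * D)))
  = quadsum N i j k l (fun a b c d ab ac ad bc bd cd Q =>
      fa a * fb b * fc c * fd d * fab ab * fac ac * fad ad * fbc bc * fbd bd
      * fcd cd * fQ Q
      * q ^+ 'C((a + b + c + d + ab + ac + ad + bc + bd + cd + 2 * Q).+1, 2)).
Proof.
(* The added units are the initial [u] and the final [v] of [co_ser]. *)
rewrite -!mulrA -[ser fa _ * _]mul1r -[ser fQ _]mulr1 /quadsum.
rewrite co_ser; apply: eq_bigr => a _; rewrite co_ser; apply: eq_bigr => b _.
rewrite co_ser; apply: eq_bigr => c _; rewrite co_ser; apply: eq_bigr => d _.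
rewrite co_ser; apply: eq_bigr => ab _; rewrite co_ser; apply: eq_bigr => ac _.
rewrite co_ser; apply: eq_bigr => ad _; rewrite co_ser; apply: eq_bigr => bc _.
rewrite co_ser; apply: eq_bigr => bd _; rewrite co_ser; apply: eq_bigr => cd _.
rewrite co_ser [RHS]big_mkcond; apply: eq_bigr => Q _.
set n := (a + b + c + d + ab + ac + ad + bc + bd + cd + 2 * Q)%N.
set w := _ * fQ Q.
rewrite [X in co _ _ _ _ X](_ : _ = emb w * (A ^+ (a + ab + ac + ad + Q)
  * (B ^+ (b + ab + bc + bd + Q) * (C ^+ (c + ac + bc + cd + Q)
    * (D ^+ (d + ad + bd + cd + Q) * x ^+ n))))).
  by rewrite coZ co_mono; case: ifP => _; rewrite ?mulr0.
rewrite {}/w /n !(rmorphM emb) !exprMn !exprD; ring.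
Qed.

End Expansion.

(** * The exponent of q as a natural number *)

Lemma T_nat (n : nat) : T n = 'C(n.+1, 2).
Proof.
have e : n%:Z * (n%:Z + 1) = (n.+1 * n)%N by lia.
by rewrite /T e (divz_nat _ 2) bin2 divn2.
Qed.

Lemma T_pred (n : nat) : T (n%:Z - 1) = 'C(n, 2).
Proof.
by case: n => [//|n]; rewrite -T_nat; congr T; rewrite -addn1 PoszD addrK.
Qed.

(** The identity T_(t + 2 Q) = T_t + 4 T_(Q-1) + 3 Q + 2 Q t behind the variable [x]; here
    ['C(Q, 2)] is T_(Q-1). *)
Lemma binD2 t Q :
  'C((t + 2 * Q).+1, 2) = ('C(t.+1, 2) + 4 * 'C(Q, 2) + 3 * Q + 2 * Q * t)%N.
Proof.
elim: Q => [|Q IH]; first by rewrite bin0n !muln0 !addn0.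
have -> : (t + 2 * Q.+1).+1 = (t + 2 * Q).+3 by lia.
by rewrite (binS _.+2) (binS _.+1) (binS Q) !bin1 IH; lia.
Qed.

(** The subtracted bc, bd, cd are absorbed by T_n - n = T_(n-1), so no negative power of q
    remains. *)
Lemma qexponentE (a b c d ab ac ad bc bd cd Q : nat) :
  qexponent a b c d ab ac ad bc bd cd Q
  = ('C((a + b + c + d + ab + ac + ad + bc + bd + cd + 2 * Q).+1, 2)
     + 'C(ab.+1, 2) + 'C(ac.+1, 2) + 'C(ad.+1, 2)
     + 'C(bc, 2) + 'C(bd, 2) + 'C(cd, 2))%N.
Proof.
rewrite binD2 /qexponent.
set t := (a + b + c + d + ab + ac + ad + bc + bd + cd)%N.
rewrite (_ : a%:Z + b + c + d + ab + ac + ad + bc + bd + cd = t); last by lia.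
by rewrite T_pred !T_nat (binS bc) (binS bd) (binS cd) !bin1; lia.
Qed.

Lemma quadsum0 (K : fieldType) N F :
  quadsum N.+1 0 0 0 0 F = F 0 0 0 0 0 0 0 0 0 0 0 :> K.
Proof.
have sum0 (f : nat -> K) : (forall m, f m.+1 = 0) ->
    \sum_(0 <= m < N.+1) f m = f 0%N.
  by move=> f0; rewrite big_nat_recl // big1 ?addr0.
rewrite /quadsum; do 10!(rewrite sum0; last by
  move=> m; do !(apply: big1 => ? ?); lia).
by rewrite big_mkcond sum0 // => m; rewrite ifF //; lia.
Qed.

(** * Recurrences and closed form of the inner sums *)

Definition substitutes (K R : Type) (emb : K -> R) (A B C D x : R)
    (s : R -> R) (a b c d y : R) :=
  (forall r, s (emb r) = emb r) /\
  [/\ s A = a, s B = b, s C = c, s D = d & s x = y].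

Section InnerSum.
Variables (K : fieldType) (q : K).
Hypothesis q_unity : forall n, 1 - q ^+ n.+1 != 0.

Let ic n := (qpoch q q n)^-1.

Lemma qpoch0 x : qpoch q x 0 = 1.
Proof. by rewrite /qpoch big_geq. Qed.

Lemma qpochS x n : qpoch q x n.+1 = qpoch q x n * (1 - x * q ^+ n).
Proof. by rewrite /qpoch big_nat_recr. Qed.

Lemma icS n : ic n.+1 * (1 - q ^+ n.+1) = ic n.
Proof. by rewrite /ic qpochS -exprS invfM mulfVK. Qed.

Variables (R : comNzRingType) (emb : {rmorphism K -> R}) (A B C D x : R).
Variable co : nat -> nat -> nat -> nat -> R -> K.
Hypothesis coD : forall i j k l f g,
  co i j k l (f + g) = co i j k l f + co i j k l g.
Hypothesis coZ : forall i j k l a f, co i j k l (emb a * f) = a * co i j k l f.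
Hypothesis co_mono : forall i j k l i' j' k' l' n,
  co i j k l (A ^+ i' * (B ^+ j' * (C ^+ k' * (D ^+ l' * x ^+ n))))
  = if [&& i == i', j == j', k == k' & l == l'] then q ^+ 'C(n.+1, 2) else 0.

Let cf n := emb (ic n).

(** A q-shift of the argument multiplies the n-th coefficient by q^n. The shifts in [bracketed] thus
    produce the powers of q in the bracket, and the differences produce 1 - q^a and 1 - q^b. *)
Lemma co_bracketed N i j k l :
  co i j k l (bracketed (emb q) cf N A B C D x)
  = quadsum N.+1 i j k l (summand q).
Proof.
have e1 z : eser cf N z = ser emb N.+1 ic z by [].
have eq z : eser cf N (emb q * z) = ser emb N.+1 (fun n => q ^+ n * ic n) z.
  apply: eq_bigr => n _.
  by rewrite exprMn (rmorphM emb) (rmorphXn emb); ring.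
have ed z : eser cf N z - eser cf N (emb q * z)
            = ser emb N.+1 (fun n => (1 - q ^+ n) * ic n) z.
  rewrite eq e1 /ser -sumrB; apply: eq_bigr => n _.
  by rewrite !(rmorphM emb) rmorphB rmorph1; ring.
have E1 z : Eser (emb q) cf N z
            = ser emb N.+1 (fun n => q ^+ 'C(n, 2) * ic n) z.
  by apply: eq_bigr => n _; rewrite (rmorphM emb) (rmorphXn emb).
have Eq z : Eser (emb q) cf N (emb q * z)
            = ser emb N.+1 (fun n => q ^+ 'C(n.+1, 2) * ic n) z.
  apply: eq_bigr => n _.
  by rewrite exprMn (rmorphM emb) (rmorphXn emb) binS bin1 exprD; ring.
rewrite /bracketed !ed !eq !Eq !E1 !e1 !coD.
rewrite !(co_prod coD coZ co_mono) !quadsumD.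
apply: eq_quadsum => a b c d ab ac ad bc bd cd Q.
rewrite /summand qexponentE -exprnP !invfM -/(ic _).
rewrite !(binS bc) !(binS bd) !(binS cd) !bin1.
(* This exponent is common to both sides and needs no expansion. *)
move: 'C((a + b + c + d + ab + ac + ad + bc + bd + cd + 2 * Q).+1, 2) => m.
rewrite !exprD.
rewrite -/(ic a) -/(ic b) -/(ic c) -/(ic d) -/(ic ab) -/(ic ac) -/(ic ad).
rewrite -/(ic bc) -/(ic bd) -/(ic cd) -/(ic Q).
ring.
Qed.

Variables scaleA scaleB scaleC scaleD scalex : {rmorphism R -> R}.
Hypothesis coXA : forall i j k l f, co i.+1 j k l (A * f) = co i j k l f.
Hypothesis coXB : forall i j k l f, co i j.+1 k l (B * f) = co i j k l f.
Hypothesis coXC : forall i j k l f, co i j k.+1 l (C * f) = co i j k l f.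
Hypothesis coXD : forall i j k l f, co i j k l.+1 (D * f) = co i j k l f.
Hypothesis co_ideal : forall n i j k l u v w t,
  (i < n)%N -> (j < n)%N -> (k < n)%N -> (l < n)%N ->
  co i j k l (A ^+ n * u + B ^+ n * v + C ^+ n * w + D ^+ n * t) = 0.
Hypothesis coA : forall i j k l f,
  co i j k l (scaleA f) = q ^+ i * co i j k l f.
Hypothesis coB : forall i j k l f,
  co i j k l (scaleB f) = q ^+ j * co i j k l f.
Hypothesis coC : forall i j k l f,
  co i j k l (scaleC f) = q ^+ k * co i j k l f.
Hypothesis coDD : forall i j k l f,
  co i j k l (scaleD f) = q ^+ l * co i j k l f.
Hypothesis coXx : forall i j k l f,
  co i j k l (x * f) = q * co i j k l (scalex f).

Hypothesis scaleAP : substitutes emb A B C D x scaleA (emb q * A) B C D x.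
Hypothesis scaleBP : substitutes emb A B C D x scaleB A (emb q * B) C D x.
Hypothesis scaleCP : substitutes emb A B C D x scaleC A B (emb q * C) D x.
Hypothesis scaleDP : substitutes emb A B C D x scaleD A B C (emb q * D) x.
Hypothesis scalexP : substitutes emb A B C D x scalex A B C D (emb q * x).

Section Recurrence.
Variable N : nat.

(** The ideal generated by the powers [N.+1] of the four variables: coefficients with all indices at
    most [N] do not see it. *)
Let Id (f : R) := exists u v w t,
  f = A ^+ N.+1 * u + B ^+ N.+1 * v + C ^+ N.+1 * w + D ^+ N.+1 * t.

Let Id0 : Id 0.
Proof. by exists 0, 0, 0, 0; ring. Qed.

Let IdD f g : Id f -> Id g -> Id (f + g).
Proof.
move=> [u [v [w [t ->]]]] [u' [v' [w' [t' ->]]]].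
by exists (u + u'), (v + v'), (w + w'), (t + t'); ring.
Qed.

Let IdM f g : Id g -> Id (f * g).
Proof.
move=> [u [v [w [t ->]]]].
by exists (f * u), (f * v), (f * w), (f * t); ring.
Qed.

Let smallA : small Id N A.
Proof. by exists 1, 0, 0, 0; ring. Qed.

Let smallB : small Id N B.
Proof. by exists 0, 1, 0, 0; ring. Qed.

Let smallC : small Id N C.
Proof. by exists 0, 0, 1, 0; ring. Qed.

Let smallD : small Id N D.
Proof. by exists 0, 0, 0, 1; ring. Qed.

Let coN i j k l f : co i j k l (- f) = - co i j k l f.
Proof. by rewrite -mulN1r -(rmorph1 emb) -rmorphN coZ mulN1r. Qed.

Let cfS n : cf n.+1 * (1 - emb q ^+ n.+1) = cf n.
Proof.
by rewrite /cf -(icS n) (rmorphM emb) (rmorphB emb) (rmorphXn emb) rmorph1.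
Qed.

Let co_eqI i j k l f g : (i <= N)%N -> (j <= N)%N -> (k <= N)%N -> (l <= N)%N ->
  eqI Id f g -> co i j k l f = co i j k l g.
Proof.
move=> iN jN kN lN [u [v [w [t /eqP]]]]; rewrite subr_eq => /eqP ->.
by rewrite coD co_ideal ?add0r.
Qed.

Let G := symquad (emb q) cf N.

(** The telescoping congruence read through [co]: as [scalex] fixes a, b, c, d, it carries p(x) to
    p(qx), and [coXx] makes the two terms of the certificate cancel. *)
Let co_functional a b c d i j k l :
  small Id N a -> small Id N b -> small Id N c -> small Id N d ->
  [/\ scalex a = a, scalex b = b, scalex c = c & scalex d = d] ->
  (i <= N)%N -> (j <= N)%N -> (k <= N)%N -> (l <= N)%N ->
  co i j k l (G a b c d x)
  = co i j k l ((1 + emb q * a) * G (emb q * a) b c d x).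
Proof.
move=> sa sb sc sd [xa xb xc xd] iN jN kN lN.
have := co_eqI iN jN kN lN (quadprod_telescopes Id0 IdD IdM cfS x sa sb sc sd).
rewrite -/(symquad (emb q) cf N _ _ _ _ _).
rewrite -/(symquad (emb q) cf N (emb q * a) _ _ _ _) -/G.
have [sq [_ _ _ _ sx]] := scalexP.
rewrite 2!coD 2!coN coXx coZ (rmorph_telescoper _ (sq _) (fun n => sq _)).
rewrite xa xb xc xd sx subrr.
by move/eqP; rewrite subr_eq0 => /eqP.
Qed.

(** In G(a) = (1 + qa) G(qa), the summand 1 contributes q^(m+1) times the same coefficient, and qa
    contributes q times q^m times the lowered one. *)
Let co_step (s : {rmorphism R -> R}) a i j k l i' j' k' l' m :
  (forall f, co i j k l (s f) = q ^+ m.+1 * co i j k l f) ->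
  (forall f, co i' j' k' l' (s f) = q ^+ m * co i' j' k' l' f) ->
  (forall f, co i j k l (a * f) = co i' j' k' l' f) ->
  co i j k l (G A B C D x)
  = co i j k l ((1 + emb q * a) * s (G A B C D x)) ->
  co i j k l (G A B C D x) * (1 - q ^+ m.+1)
  = co i' j' k' l' (G A B C D x) * q ^+ m.+1.
Proof.
move=> cs cs' ca; rewrite mulrDl mul1r -mulrA coD coZ ca cs cs' => e.
by rewrite mulrBr mulr1 {1}e exprS; ring.
Qed.

Let scaleG (s : {rmorphism R -> R}) a b c d y :
  substitutes emb A B C D x s a b c d y ->
  s (G A B C D x) = G a b c d y.
Proof.
move=> [sq [sA sB sC sD sx]].
by rewrite /G /symquad (rmorphM s) (rmorph_quadprod _ (sq _) (fun n => sq _))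
  rmorph_symfactor
  sA sB sC sD sx.
Qed.

Let fixx : [/\ scalex A = A, scalex B = B, scalex C = C & scalex D = D].
Proof. by case: scalexP => _ [-> -> -> ->]. Qed.

Let recA i j k l : (i < N)%N -> (j <= N)%N -> (k <= N)%N -> (l <= N)%N ->
  co i.+1 j k l (G A B C D x) * (1 - q ^+ i.+1)
  = co i j k l (G A B C D x) * q ^+ i.+1.
Proof.
move=> iN jN kN lN; apply: (@co_step scaleA A) => //.
by rewrite (scaleG scaleAP); apply: co_functional.
Qed.

Let recB i j k l : (i <= N)%N -> (j < N)%N -> (k <= N)%N -> (l <= N)%N ->
  co i j.+1 k l (G A B C D x) * (1 - q ^+ j.+1)
  = co i j k l (G A B C D x) * q ^+ j.+1.
Proof.
move=> iN jN kN lN; apply: (@co_step scaleB B) => //.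
(* Symmetry moves [B] to the first place, where [co_functional] applies. *)
rewrite (scaleG scaleBP) /G !(symquadAB _ _ _ A _ C).
by apply: co_functional => //; case: fixx.
Qed.

Let recC i j k l : (i <= N)%N -> (j <= N)%N -> (k < N)%N -> (l <= N)%N ->
  co i j k.+1 l (G A B C D x) * (1 - q ^+ k.+1)
  = co i j k l (G A B C D x) * q ^+ k.+1.
Proof.
move=> iN jN kN lN; apply: (@co_step scaleC C) => //.
rewrite (scaleG scaleCP) /G !(symquadAC _ _ _ A B).
by apply: co_functional => //; case: fixx.
Qed.

Let recD i j k l : (i <= N)%N -> (j <= N)%N -> (k <= N)%N -> (l < N)%N ->
  co i j k l.+1 (G A B C D x) * (1 - q ^+ l.+1)
  = co i j k l (G A B C D x) * q ^+ l.+1.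
Proof.
move=> iN jN kN lN; apply: (@co_step scaleD D) => //.
rewrite (scaleG scaleDP) /G !(symquadAD _ _ _ A B).
by apply: co_functional => //; case: fixx.
Qed.

Let w n := q ^+ 'C(n.+1, 2) * ic n.

(** The weights [w] obey the same first order recurrence with [w 0] equal to 1, and 1 - q^(m+1) can
    be cancelled. *)
Let closed_step (g : nat -> K) : (forall m, (m < N)%N ->
   g m.+1 * (1 - q ^+ m.+1) = g m * q ^+ m.+1) ->
  forall m, (m <= N)%N -> g m = w m * g 0%N.
Proof.
move=> gS; elim=> [|m IH] mN; first by rewrite /w /ic qpoch0 invr1 !mul1r.
apply: (mulIf (q_unity m)); rewrite gS // IH 1?ltnW // /w -[in LHS](icS m).
by rewrite (binS m.+1) bin1 exprD; ring.
Qed.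

Let G_closed i j k l : (i <= N)%N -> (j <= N)%N -> (k <= N)%N -> (l <= N)%N ->
  co i j k l (G A B C D x)
  = w i * (w j * (w k * (w l * co 0%N 0%N 0%N 0%N (G A B C D x)))).
Proof.
move=> iN jN kN lN.
rewrite (@closed_step (fun m => co m j k l (G A B C D x))) //; last first.
  by move=> m mN; apply: recA.
rewrite (@closed_step (fun m => co 0%N m k l (G A B C D x))) //; last first.
  by move=> m mN; apply: recB.
rewrite (@closed_step (fun m => co 0%N 0%N m l (G A B C D x))) //; last first.
  by move=> m mN; apply: recC.
rewrite (@closed_step (fun m => co 0%N 0%N 0%N m (G A B C D x))) // => m mN.
exact: recD.
Qed.

Lemma co_bracketed_closed i j k l :
  (i <= N)%N -> (j <= N)%N -> (k <= N)%N -> (l <= N)%N ->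
  co i j k l (bracketed (emb q) cf N A B C D x)
  = w i * (w j * (w k * (w l
      * co 0%N 0%N 0%N 0%N (bracketed (emb q) cf N A B C D x)))).
Proof.
move=> iN jN kN lN.
have e := bracketedE Id0 IdD IdM cfS x smallA smallB smallC smallD.
by rewrite (co_eqI iN jN kN lN e) [in RHS](co_eqI _ _ _ _ e) // G_closed.
Qed.

End Recurrence.

Lemma inner_sum_of_functional i j k l : inner_sum q i j k l
  = q ^+ 'C(i.+1, 2) * ic i * (q ^+ 'C(j.+1, 2) * ic j)
    * (q ^+ 'C(k.+1, 2) * ic k) * (q ^+ 'C(l.+1, 2) * ic l).
Proof.
(* This truncation order matches the ranges of [inner_sum] and dominates all four indices. *)
have := @co_bracketed_closed (i + j + k + l) i j k l.
rewrite !co_bracketed quadsum0 -[quadsum _ i j k l _]/(inner_sum q i j k l).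
move=> ->; try lia.
(* At zero indices only the last term of the bracket survives, so the initial value is 1. *)
rewrite /summand qexponentE !qpoch0 !(expr0, mulr1, invr1, subrr, mulr0, add0r).
by rewrite !mulrA.
Qed.

End InnerSum.

(** * The ring K[x][A][B][C][D] *)

(** Polynomials as a bundled ring, ready to be the coefficient ring of the next layer. *)
Definition polyring (P : comNzRingType) : comNzRingType := {poly P}.

Section Layer.
Variables (K : fieldType) (P : comNzRingType).

Definition pC : P -> polyring P := polyC.
HB.instance Definition _ := GRing.RMorphism.on pC.
Definition pX : polyring P := 'X.
Definition pco (co : P -> K) (l : nat) (f : polyring P) : K :=
  co (f : {poly P})`_l.
Definition pmap (s : P -> P) : polyring P -> polyring P := map_poly s.
Definition pscale (a : P) : polyring P -> polyring P := comp_poly (a *: 'X).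
HB.instance Definition _ a := GRing.RMorphism.on (pscale a).

Lemma pcoD co l : {morph co : f g / f + g} -> {morph pco co l : f g / f + g}.
Proof. by move=> coD f g; rewrite /pco coefD coD. Qed.

(** Lifts the effect of a multiplication through an outer layer. As [co'] is arbitrary, this covers
    scalars as well as index shifts. *)
Lemma pcoM (co co' : P -> K) y : (forall g, co (y * g) = co' g) ->
  forall l f, pco co l (pC y * f) = pco co' l f.
Proof. by move=> coy l f; rewrite /pco coefCM coy. Qed.

Lemma pcoXS co l f : pco co l.+1 (pX * f) = pco co l f.
Proof. by rewrite /pco coefXM. Qed.

Lemma pcoXn co n l f : co 0 = 0 ->
  pco co l (pX ^+ n * f) = if (l < n)%N then 0 else pco co (l - n) f.
Proof. by move=> co0; rewrite /pco coefXnM; case: ifP. Qed.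

Lemma pco_C co l y : co 0 = 0 -> pco co l (pC y) = if l == 0%N then co y else 0.
Proof. by move=> co0; rewrite /pco coefC; case: ifP. Qed.

Lemma pco_map (s : {rmorphism P -> P}) b co :
  (forall g, co (s g) = b * co g) ->
  forall l f, pco co l (pmap s f) = b * pco co l f.
Proof. by move=> cos l f; rewrite /pco coef_map cos. Qed.

Lemma pcoM_map (s : {rmorphism P -> P}) y b co :
  (forall g, co (y * g) = b * co (s g)) ->
  forall l f, pco co l (pC y * f) = b * pco co l (pmap s f).
Proof. by move=> coy l f; rewrite /pco coefCM coef_map coy. Qed.

(** The coefficient of degree l acquires a^l, and [co] turns each factor [a] into the scalar [b]. *)
Lemma pco_scale (b : K) (a : P) co : (forall g, co (a * g) = b * co g) ->
  forall l f, pco co l (pscale a f) = b ^+ l * pco co l f.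
Proof.
move=> coa l f; rewrite /pco coef_scale; elim: l (_`_l) => [|l IH] g.
  by rewrite !expr0 !mul1r.
by rewrite !exprS -!mulrA coa IH.
Qed.

Lemma pmapC (s : {rmorphism P -> P}) y z :
  s y = z -> pmap s (pC y) = pC z.
Proof. by move=> <-; exact: map_polyC. Qed.

Lemma pmapCM (s : {rmorphism P -> P}) a y :
  s y = a * y -> pmap s (pC y) = pC a * pC y.
Proof. by move=> sy; rewrite (pmapC sy) rmorphM. Qed.

Lemma pmapX (s : {rmorphism P -> P}) : pmap s pX = pX.
Proof. exact: map_polyX. Qed.

Lemma pscaleC a y : pscale a (pC y) = pC y.
Proof. exact: comp_polyC. Qed.

Lemma pscaleX a : pscale a pX = pC a * pX.
Proof. by rewrite /pscale comp_polyX mul_polyC. Qed.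

End Layer.

HB.instance Definition _ (P : comNzRingType) (s : {rmorphism P -> P}) :=
  GRing.RMorphism.copy (pmap s) (map_poly s).

Section Nested.
Variables (K : fieldType) (q : K).

Let R0 := polyring K.
Let R1 := polyring R0.
Let R2 := polyring R1.
Let R3 := polyring R2.
Let R4 := polyring R3.

Definition emb : K -> R4 :=
  @pC R3 \o (@pC R2 \o (@pC R1 \o (@pC R0 \o @pC K))).
HB.instance Definition _ := GRing.RMorphism.on emb.

(** The variable [x] is innermost, so that [trisum] acts after the four coefficients are extracted;
    A, B, C, D follow outwards. *)
Definition vx : R4 := pC (pC (pC (pC (pX K)))).
Definition vA : R4 := pC (pC (pC (pX R0))).
Definition vB : R4 := pC (pC (pX R1)).
Definition vC : R4 := pC (pX R2).
Definition vD : R4 := pX R3.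

Let co1 i : R1 -> K := pco (trisum q) i.
Let co2 i j : R2 -> K := pco (co1 i) j.
Let co3 i j k : R3 -> K := pco (co2 i j) k.
Definition trico i j k l : R4 -> K := pco (co3 i j k) l.

(** Each scaling acts in the layer of its variable and coefficientwise in the layers outside it. *)
Definition scaleA : R4 -> R4 := pmap (pmap (pmap (pscale (pC q)))).
Definition scaleB : R4 -> R4 := pmap (pmap (pscale (pC (pC q)))).
Definition scaleC : R4 -> R4 := pmap (pscale (pC (pC (pC q)))).
Definition scaleD : R4 -> R4 := pscale (pC (pC (pC (pC q)))).
Definition scalex : R4 -> R4 := pmap (pmap (pmap (pmap (pscale q)))).
HB.instance Definition _ := GRing.RMorphism.on scaleA.
HB.instance Definition _ := GRing.RMorphism.on scaleB.
HB.instance Definition _ := GRing.RMorphism.on scaleC.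
HB.instance Definition _ := GRing.RMorphism.on scaleD.
HB.instance Definition _ := GRing.RMorphism.on scalex.

Let trisumC a (g : R0) : trisum q (pC a * g) = a * trisum q g.
Proof. exact: trisumZ. Qed.

Let trisum0 : trisum q 0 = 0.
Proof. by rewrite /trisum size_poly0 big_geq. Qed.

Let co10 i : co1 i 0 = 0.
Proof. by rewrite /co1 /pco coef0. Qed.

Let co20 i j : co2 i j 0 = 0.
Proof. by rewrite /co2 /pco coef0. Qed.

Let co30 i j k : co3 i j k 0 = 0.
Proof. by rewrite /co3 /pco coef0. Qed.

Lemma tricoD i j k l : {morph trico i j k l : f g / f + g}.
Proof. by do 4!apply: pcoD; apply: trisumD. Qed.

Let co1C i a (g : R1) : co1 i (pC (pC a) * g) = a * co1 i g.
Proof. exact: (pcoM (trisumC a)). Qed.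

Let co2C i j a (g : R2) : co2 i j (pC (pC (pC a)) * g) = a * co2 i j g.
Proof. exact: (pcoM (@co1C i a)). Qed.

Let co3C i j k a (g : R3) :
  co3 i j k (pC (pC (pC (pC a))) * g) = a * co3 i j k g.
Proof. exact: (pcoM (@co2C i j a)). Qed.

Lemma tricoZ i j k l a f : trico i j k l (emb a * f) = a * trico i j k l f.
Proof. exact: (pcoM (@co3C i j k a)). Qed.

Lemma tricoXA i j k l f : trico i.+1 j k l (vA * f) = trico i j k l f.
Proof. by do 3!apply: pcoM => ?; apply: pcoXS. Qed.

Lemma tricoXB i j k l f : trico i j.+1 k l (vB * f) = trico i j k l f.
Proof. by do 2!apply: pcoM => ?; apply: pcoXS. Qed.

Lemma tricoXC i j k l f : trico i j k.+1 l (vC * f) = trico i j k l f.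
Proof. by apply: pcoM => ?; apply: pcoXS. Qed.

Lemma tricoXD i j k l f : trico i j k l.+1 (vD * f) = trico i j k l f.
Proof. exact: pcoXS. Qed.

Lemma tricoXnA n i j k l f :
  trico i j k l (vA ^+ n * f) = if (i < n)%N then 0 else trico (i - n) j k l f.
Proof.
rewrite /vA -!rmorphXn.
(* The guard is explicit because [i - n] is truncated at 0. *)
pose co' g := if (i < n)%N then 0 else co1 (i - n) g.
have -> : trico i j k l (pC (pC (pC (pX R0 ^+ n))) * f)
    = pco (pco (pco co' j) k) l f.
  by do 3!apply: pcoM => ?; apply: pcoXn.
by rewrite /pco /co'; case: ifP.
Qed.

Lemma tricoXnB n i j k l f :
  trico i j k l (vB ^+ n * f) = if (j < n)%N then 0 else trico i (j - n) k l f.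
Proof.
rewrite /vB -!rmorphXn.
pose co' g := if (j < n)%N then 0 else co2 i (j - n) g.
have -> : trico i j k l (pC (pC (pX R1 ^+ n)) * f) = pco (pco co' k) l f.
  by do 2!apply: pcoM => ?; apply: pcoXn (co10 i).
by rewrite /pco /co'; case: ifP.
Qed.

Lemma tricoXnC n i j k l f :
  trico i j k l (vC ^+ n * f) = if (k < n)%N then 0 else trico i j (k - n) l f.
Proof.
rewrite /vC -!rmorphXn.
pose co' g := if (k < n)%N then 0 else co3 i j (k - n) g.
have -> : trico i j k l (pC (pX R2 ^+ n) * f) = pco co' l f.
  by apply: pcoM => ?; apply: pcoXn (co20 i j).
by rewrite /pco /co'; case: ifP.
Qed.

Lemma tricoXnD n i j k l f :
  trico i j k l (vD ^+ n * f) = if (l < n)%N then 0 else trico i j k (l - n) f.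
Proof. exact: pcoXn (co30 i j k). Qed.

Lemma tricoxn n i j k l : trico i j k l (vx ^+ n)
  = if [&& i == 0, j == 0, k == 0 & l == 0]%N then q ^+ 'C(n.+1, 2) else 0.
Proof.
rewrite /vx -!rmorphXn /trico (pco_C _ _ (co30 i j k)) /co3.
rewrite (pco_C _ _ (co20 i j)) /co2 (pco_C _ _ (co10 i)) /co1.
rewrite (pco_C _ _ trisum0) -(trisumXn q n).
by case: l k j i => [|l] [|k] [|j] [|i].
Qed.

Lemma trico_mono i j k l i' j' k' l' n :
  trico i j k l (vA ^+ i' * (vB ^+ j' * (vC ^+ k' * (vD ^+ l' * vx ^+ n))))
  = if [&& i == i', j == j', k == k' & l == l'] then q ^+ 'C(n.+1, 2) else 0.
Proof.
(* The remaining tests only say i <= i' and so on; the guards supply the reverse inequalities. *)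
rewrite tricoXnA tricoXnB tricoXnC tricoXnD tricoxn !subn_eq0.
case: ltnP => Hi; first by rewrite (ltn_eqF Hi).
case: ltnP => Hj; first by rewrite (ltn_eqF Hj) andbF.
case: ltnP => Hk; first by rewrite (ltn_eqF Hk) !andbF.
case: ltnP => Hl; first by rewrite (ltn_eqF Hl) !andbF.
by rewrite !eqn_leq Hi Hj Hk Hl !andbT.
Qed.

Lemma trico_ideal n i j k l u v w t :
  (i < n)%N -> (j < n)%N -> (k < n)%N -> (l < n)%N ->
  trico i j k l (vA ^+ n * u + vB ^+ n * v + vC ^+ n * w + vD ^+ n * t) = 0.
Proof.
move=> iN jN kN lN.
by rewrite 3!tricoD tricoXnA tricoXnB tricoXnC tricoXnD iN jN kN lN !addr0.
Qed.

Lemma trico_scaleA i j k l f :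
  trico i j k l (scaleA f) = q ^+ i * trico i j k l f.
Proof. by do 3!apply: pco_map => ?; apply: pco_scale; apply: trisumC. Qed.

Lemma trico_scaleB i j k l f :
  trico i j k l (scaleB f) = q ^+ j * trico i j k l f.
Proof. by do 2!apply: pco_map => ?; apply: pco_scale; apply: co1C. Qed.

Lemma trico_scaleC i j k l f :
  trico i j k l (scaleC f) = q ^+ k * trico i j k l f.
Proof. by apply: pco_map => ?; apply: pco_scale; apply: co2C. Qed.

Lemma trico_scaleD i j k l f :
  trico i j k l (scaleD f) = q ^+ l * trico i j k l f.
Proof. by apply: pco_scale; apply: co3C. Qed.

Lemma tricoXx i j k l f :
  trico i j k l (vx * f) = q * trico i j k l (scalex f).
Proof. by do 4!apply: pcoM_map => ?; apply: trisumX. Qed.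

Lemma scaleA_substitutes : substitutes emb vA vB vC vD vx scaleA
  (emb q * vA) vB vC vD vx.
Proof.
split=> [r|]; first by do 3!apply: pmapC; apply: pscaleC.
split.
- by do 3!apply: pmapCM; apply: pscaleX.
- by do 2!apply: pmapC; apply: pmapX.
- by apply: pmapC; apply: pmapX.
- by apply: pmapX.
- by do 3!apply: pmapC; apply: pscaleC.
Qed.

Lemma scaleB_substitutes : substitutes emb vA vB vC vD vx scaleB
  vA (emb q * vB) vC vD vx.
Proof.
split=> [r|]; first by do 2!apply: pmapC; apply: pscaleC.
split.
- by do 2!apply: pmapC; apply: pscaleC.
- by do 2!apply: pmapCM; apply: pscaleX.
- by apply: pmapC; apply: pmapX.
- by apply: pmapX.
- by do 2!apply: pmapC; apply: pscaleC.
Qed.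

Lemma scaleC_substitutes : substitutes emb vA vB vC vD vx scaleC
  vA vB (emb q * vC) vD vx.
Proof.
split=> [r|]; first by apply: pmapC; apply: pscaleC.
split.
- by apply: pmapC; apply: pscaleC.
- by apply: pmapC; apply: pscaleC.
- by apply: pmapCM; apply: pscaleX.
- by apply: pmapX.
- by apply: pmapC; apply: pscaleC.
Qed.

Lemma scaleD_substitutes : substitutes emb vA vB vC vD vx scaleD
  vA vB vC (emb q * vD) vx.
Proof.
split=> [r|]; first by apply: pscaleC.
split.
- by apply: pscaleC.
- by apply: pscaleC.
- by apply: pscaleC.
- by apply: pscaleX.
- by apply: pscaleC.
Qed.

Lemma scalex_substitutes : substitutes emb vA vB vC vD vx scalex
  vA vB vC vD (emb q * vx).
Proof.
split=> [r|]; first by do 4!apply: pmapC; apply: pscaleC.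
split.
- by do 3!apply: pmapC; apply: pmapX.
- by do 2!apply: pmapC; apply: pmapX.
- by apply: pmapC; apply: pmapX.
- by apply: pmapX.
- by do 4!apply: pmapCM; apply: pscaleX.
Qed.

End Nested.

Lemma inner_sumE (K : fieldType) (q : K) i j k l :
  (forall n, 1 - q ^+ n.+1 != 0) ->
  inner_sum q i j k l
  = q ^+ 'C(i.+1, 2) / qpoch q q i * (q ^+ 'C(j.+1, 2) / qpoch q q j)
    * (q ^+ 'C(k.+1, 2) / qpoch q q k) * (q ^+ 'C(l.+1, 2) / qpoch q q l).
Proof.
move=> q_unity.
exact: (inner_sum_of_functional q_unity (@tricoD K q) (@tricoZ K q)
  (@trico_mono K q) (@tricoXA K q) (@tricoXB K q) (@tricoXC K q)
  (@tricoXD K q) (@trico_ideal K q) (@trico_scaleA K q) (@trico_scaleB K q)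
  (@trico_scaleC K q) (@trico_scaleD K q) (@tricoXx K q)
  (@scaleA_substitutes K q) (@scaleB_substitutes K q) (@scaleC_substitutes K q)
  (@scaleD_substitutes K q) (@scalex_substitutes K q)).
Qed.

(** * Absolutely summable families and Euler's identity *)

Local Open Scope classical_set_scope.

Section AbsoluteSummation.
Variables (R : realType) (I : choiceType).

(** A finite set J containing E n lies in some E m, so its terms outside E n have total modulus at
    most t minus the absolute sum over E n, which is small. *)
Lemma has_sum_exhaustion (f : I -> R[i]) (s t : R[i]) (E : nat -> seq I) :
  (forall n, uniq (E n)) -> (forall n, {subset E n <= E n.+1}) ->
  (forall x, exists n, x \in E n) ->
  (\sum_(x <- E n) f x : R[i]^o) @[n --> \oo] --> (s : R[i]^o) ->
  (\sum_(x <- E n) `|f x| : R[i]^o) @[n --> \oo] --> (t : R[i]^o) ->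
  (forall n, \sum_(x <- E n) `|f x| <= t) ->
  has_sum f s.
Proof.
move=> uE sE exh fs ft le_t.
have mE m n : (m <= n)%N -> {subset E m <= E n}.
  by move=> /subnK <-; elim: (n - m)%N => // k IH x /IH /sE.
have totally_proper := @totally_filter I.
apply/cvgrPdist_lt => e e0.
have e20 : 0 < e / 2 by rewrite divr_gt0.
move/cvgrPdist_lt : fs => /(_ _ e20) fs.
move/cvgrPdist_lt : ft => /(_ _ e20) ft.
have [n [/= dS dT]] : exists n, `|s - \sum_(x <- E n) f x| < e / 2 /\
    `|t - \sum_(x <- E n) `|f x| | < e / 2.
  have [n _ /(_ n (leqnn n)) h] := filterI fs ft.
  by exists n.
exists [fset x in E n]%fset => // J /= /fsubsetP EJ.
rewrite /partial_sum -(big_seq_fsetE _ _ predT).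
have {}EJ x : x \in E n -> x \in J by move=> xE; apply: EJ; rewrite inE.
have [m nm Jm] : exists2 m, (n <= m)%N & {subset (J : seq I) <= E m}.
  elim: (J : seq I) => [|x r [m nm rm]].
    by exists n => // x; rewrite in_nil.
  have [k xk] := exh x; exists (maxn m k); first by rewrite leq_max nm.
  move=> y; rewrite inE => /predU1P[->|/rm].
    exact: mE (leq_maxr _ _) _ xk.
  exact: mE (leq_maxl _ _) _.
have split_sum (V : zmodType) (g : I -> V) (r : seq I) : uniq r ->
    {subset E n <= r} -> \sum_(x <- r) g x =
    \sum_(x <- E n) g x + \sum_(x <- r | x \notin E n) g x.
  move=> ur sr; rewrite (bigID (fun x => x \in E n)) /=; congr (_ + _).
  rewrite -big_filter; apply: perm_big.
  apply: uniq_perm; rewrite ?filter_uniq //.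
  by move=> x; rewrite mem_filter andb_idr //; apply: sr.
rewrite (split_sum _ f (enum_fset J)) ?fset_uniq // opprD addrA.
apply: le_lt_trans (ler_normB _ _) _; rewrite [e]splitr.
apply: ltr_leD => //; apply: le_trans (ler_norm_sum _ _ _) _.
apply: (@le_trans _ _ (\sum_(x <- E m | x \notin E n) `|f x|)).
  rewrite -[leLHS]big_filter -[leRHS]big_filter.
  set r1 := seq.filter _ J; set r2 := seq.filter _ (E m).
  have u1 : uniq r1 by rewrite filter_uniq.
  have u2 : uniq r2 by rewrite filter_uniq.
  have r12 : {subset r1 <= r2}.
    by move=> x; rewrite !mem_filter => /andP[-> /Jm].
  rewrite [leRHS](bigID (fun x => x \in r1)) /=.
  have -> : \sum_(x <- r2 | x \in r1) `|f x| = \sum_(x <- r1) `|f x|.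
    rewrite -big_filter; apply: perm_big; apply: uniq_perm => //.
      by rewrite filter_uniq.
    by move=> x; rewrite mem_filter andb_idr //; apply: r12.
  by rewrite lerDl sumr_ge0.
have := le_t m; rewrite (split_sum _ _ (E m)) //; last exact: mE.
rewrite -lerBrDl => /le_trans; apply; apply: le_trans (ltW dT).
(* The order of [R[i]] is partial: bounding a number by its modulus requires it to be real, which
   nonnegativity gives. *)
by apply: real_ler_norm; rewrite ger0_real // subr_ge0.
Qed.

End AbsoluteSummation.

(** * Convergence of complex series *)

Section ComplexSeries.
Variable R : realType.
Local Notation C := R[i].

Lemma normC_real (x : R) : `|x%:C%C| = `|x|%:C%C.
Proof. by rewrite normc_def /= expr0n addr0 sqrtr_sqr. Qed.

Lemma cvg_real_complex (u : nat -> R) (l : R) :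
  u n @[n --> \oo] --> l -> ((u n)%:C%C : C^o) @[n --> \oo] --> (l%:C%C : C^o).
Proof.
move=> /cvgrPdist_lt ul; apply/cvgrPdist_lt => -[e e'].
(* A positive element of [R[i]] has zero imaginary part. *)
rewrite ltcE /= => /andP[/eqP -> e0]; apply: filterS (ul _ e0) => n.
by rewrite -rmorphB normC_real ltcR.
Qed.

Lemma cvg_seq_unique (u : nat -> C) (a b : C^o) :
  (u n : C^o) @[n --> \oo] --> a -> (u n : C^o) @[n --> \oo] --> b -> a = b.
Proof. by move=> ua ub; apply: (cvg_unique _ ua ub); exact: norm_hausdorff. Qed.

Lemma normcE (z : C) : `|z| = (Normc.normc z)%:C%C.
Proof. by []. Qed.

Lemma normc_ge0 (z : C) : 0 <= Normc.normc z.
Proof. by rewrite -lecR; exact: (normr_ge0 z). Qed.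

(** The partial sums of the moduli increase and are bounded by the real part of [M]; the real and
    imaginary parts are dominated by the moduli. *)
Lemma absolutely_convergent (u : nat -> C) (M : C) :
  (forall n, \sum_(0 <= m < n) `|u m| <= M) ->
  exists s t : C^o,
    [/\ (\sum_(0 <= m < n) u m : C^o) @[n --> \oo] --> s,
        (\sum_(0 <= m < n) `|u m| : C^o) @[n --> \oo] --> t
      & forall n, \sum_(0 <= m < n) `|u m| <= t].
Proof.
move=> uM; pose r m := Normc.normc (u m).
have r0 m : 0 <= r m by exact: normc_ge0.
have rE n : \sum_(0 <= m < n) `|u m| = (series r n)%:C%C.
  by rewrite rmorph_sum; apply: eq_bigr => m _; rewrite normcE.
have r_nd : nondecreasing_seq (series r).
  by apply/nondecreasing_seqP => n; rewrite /series /= big_nat_recr //= lerDl.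
have r_cvg : cvgn (series r).
  apply: nondecreasing_is_cvgn => //; exists (complex.Re M) => _ [n _ <-].
  by have := uM n; rewrite rE lecE => /andP[].
have part_cvg (v : nat -> R) : (forall m, `|v m| <= r m) -> cvgn (series v).
  move=> vr; apply: (@normed_cvg R R^o).
  by apply: series_le_cvg r_cvg => m /=; [exact: normr_ge0|exact: r0|exact: vr].
have re_cvg : cvgn (series (fun m => complex.Re (u m))).
  by apply: part_cvg => m; have := normc_ge_Re (u m); rewrite normcE lecR.
have im_cvg : cvgn (series (fun m => complex.Im (u m))).
  (* Multiplying by i turns the imaginary part, up to sign, into a real part and keeps the
     modulus. *)
  apply: part_cvg => m; have := normc_ge_Re (u m * 'i%C).
  by rewrite ReiNIm normrM normrN complexiE normCi mulr1 normcE lecR.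
exists ((limn (series (fun m => complex.Re (u m))))%:C%C
  + 'i%C * (limn (series (fun m => complex.Im (u m))))%:C%C).
exists (limn (series r))%:C%C.
split.
- have -> : (fun n => \sum_(0 <= m < n) u m) =
      (fun n => (series (fun m => complex.Re (u m)) n)%:C%C
        + 'i%C * (series (fun m => complex.Im (u m)) n)%:C%C).
    apply/funext => n; rewrite /series /= !rmorph_sum mulr_sumr -big_split /=.
    by apply: eq_bigr => m _; rewrite -complexE.
  apply: (@cvgD _ C^o); first exact: cvg_real_complex re_cvg.
  apply: cvgM; first exact: cvg_cst.
  exact: cvg_real_complex im_cvg.
- under eq_fun do rewrite rE.
  exact: cvg_real_complex r_cvg.
- by move=> n; rewrite rE lecR; apply: nondecreasing_cvgn_le.
Qed.

End ComplexSeries.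

(** From [N] on, the partial sum plus twice the next term does not increase. *)
Lemma ratio_bounded (R : realType) (v : nat -> R) N :
  (forall m, 0 <= v m) -> (forall m, (N <= m)%N -> v m.+1 <= v m / 2) ->
  exists M, forall n, \sum_(0 <= m < n) v m <= M.
Proof.
move=> v0 vN; pose S n := \sum_(0 <= m < n) v m.
have S_nd n k : S n <= S (n + k)%N.
  elim: k => [|k IH]; first by rewrite addn0.
  by apply: le_trans IH _; rewrite addnS /S big_nat_recr //= lerDl.
have bound k : S (N + k)%N + 2 * v (N + k)%N <= S N + 2 * v N.
  elim: k => [|k IH]; first by rewrite addn0.
  apply: le_trans IH; rewrite addnS /S big_nat_recr //= -/(S _).
  by have := vN _ (leq_addr k N); lra.
exists (S N + 2 * v N) => n; rewrite -/(S n).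
apply: le_trans (S_nd n N) _; rewrite addnC; apply: le_trans (bound n).
by rewrite lerDl mulr_ge0.
Qed.

(** * Euler's expansion of (-aq)_oo *)

Section Euler.
Variables (R : realType) (q : R[i]).
Hypothesis q_lt1 : `|q| < 1.
Local Notation C := R[i].

Lemma q_unity n : 1 - q ^+ n.+1 != 0.
Proof.
rewrite subr_eq0; apply/eqP => e.
have : `|q ^+ n.+1| < 1 by rewrite normrX exprn_ilt1.
by rewrite -e normr1 ltxx.
Qed.

Definition euler_term (a : C) n := a ^+ n * (q ^+ 'C(n.+1, 2) / qpoch q q n).

Lemma euler_term0 a : euler_term a 0 = 1.
Proof. by rewrite /euler_term qpoch0 invr1 !mulr1. Qed.

Lemma euler_termS a n :
  euler_term a n.+1 * (1 - q ^+ n.+1) = a * q ^+ n.+1 * euler_term a n.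
Proof.
rewrite /euler_term qpochS -exprS invfM (binS n.+1) bin1 exprD exprS.
rewrite -!mulrA mulVf ?q_unity // mulr1.
by ring.
Qed.

Lemma euler_term_scale a b n : euler_term (a * b) n = b ^+ n * euler_term a n.
Proof. by rewrite /euler_term exprMn; ring. Qed.

Lemma cvg_norm_expr : (`|q| ^+ n : C^o) @[n --> \oo] --> (0 : C^o).
Proof.
have r0 := normc_ge0 q; have := q_lt1; rewrite normcE ltcR => r1.
have /cvg_expr/cvg_real_complex : `|Normc.normc q| < 1 by rewrite ger0_norm.
by under eq_fun do rewrite rmorphXn /=.
Qed.

(** The ratio of consecutive moduli is at most |a| |q|^(m+1) / (1 - |q|), because |1 - q^(m+1)| >= 1
    - |q|; it eventually drops below 1/2. *)
Lemma euler_term_bounded a :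
  exists M, forall n, \sum_(0 <= m < n) `|euler_term a m| <= M.
Proof.
pose rho := Normc.normc q; pose c := Normc.normc a.
have rho0 : 0 <= rho := normc_ge0 q; have c0 : 0 <= c := normc_ge0 a.
have rho1 : rho < 1 by have := q_lt1; rewrite normcE ltcR.
pose v m := Normc.normc (euler_term a m).
have v0 m : 0 <= v m by exact: normc_ge0.
have normcX (z : C) n : Normc.normc (z ^+ n) = Normc.normc z ^+ n.
  by elim: n => [|n IH]; rewrite ?Normc.normc1 // !exprS Normc.normcM IH.
have vS m : v m.+1 * (1 - rho) <= v m * (c * rho ^+ m.+1).
  have -> : v m * (c * rho ^+ m.+1) = v m.+1 * Normc.normc (1 - q ^+ m.+1).
    rewrite /v -[RHS]Normc.normcM euler_termS !Normc.normcM !normcX /c /rho.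
    by ring.
  apply: ler_wpM2l => //.
  apply: (@le_trans _ _ (1 - rho ^+ m.+1)).
    by rewrite lerD2l lerN2 exprS ler_piMr // exprn_ile1 // ltW.
  have := lerB_dist 1 (q ^+ m.+1).
  rewrite normr1 normrX normcE -rmorphXn -(rmorph1 (real_complex R)) -rmorphB.
  by rewrite lecR.
have [N vN] : exists N, forall m, (N <= m)%N -> v m.+1 <= v m / 2.
  (* Using c + 1 in place of c keeps the denominator positive when a = 0. *)
  have c1 : 0 < 2 * (c + 1) by rewrite mulr_gt0 // ltr_wpDl.
  have e0 : 0 < (1 - rho) / (2 * (c + 1)) by rewrite divr_gt0 ?subr_gt0.
  have /cvg_expr/cvgrPdist_lt/(_ _ e0)[N _ h] : `|rho| < 1 by rewrite ger0_norm.
  exists N => m Nm; have := h m.+1 (leqW Nm).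
  rewrite /= sub0r normrN ger0_norm ?exprn_ge0 // ltr_pdivlMr // => hm.
  have rm0 : 0 <= rho ^+ m.+1 by rewrite exprn_ge0.
  have c_small : c * rho ^+ m.+1 <= (1 - rho) / 2 by lra.
  have := le_trans (vS m) (ler_wpM2l (v0 m) c_small).
  by rewrite mulrA [_ / 2]mulrAC ler_pM2r // subr_gt0.
have [M vM] := ratio_bounded v0 vN.
exists M%:C%C => n.
rewrite (_ : \sum_(_ <= _ < _) _ = (\sum_(0 <= m < n) v m)%:C%C) ?lecR //.
by rewrite rmorph_sum.
Qed.

Definition euler_sum (a : C) : C :=
  lim ((\sum_(0 <= m < n) euler_term a m : C^o) @[n --> \oo]).

Lemma cvg_euler_sum a :
  (\sum_(0 <= m < n) euler_term a m : C^o) @[n --> \oo] --> (euler_sum a : C^o).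
Proof.
have [M /absolutely_convergent[s [t [us _ _]]]] := euler_term_bounded a.
by have -> // : euler_sum a = s; exact: cvg_lim us.
Qed.

(** By [euler_termS], the term n+1 at a minus the one at aq equals aq times the term n at aq. *)
Lemma euler_sumS a : euler_sum a = (1 + a * q) * euler_sum (a * q).
Proof.
apply: (@cvg_seq_unique _ (fun n => \sum_(0 <= m < n.+1) euler_term a m)).
  by have := @cvg_euler_sum a; rewrite -cvg_shiftS.
have -> : (fun n => \sum_(0 <= m < n.+1) euler_term a m) =
    (fun n => \sum_(0 <= m < n.+1) euler_term (a * q) m
              + a * q * \sum_(0 <= m < n) euler_term (a * q) m).
  apply/funext => n; rewrite big_nat_recl // [in RHS]big_nat_recl //.
  rewrite !euler_term0 -addrA mulr_sumr -big_split /=; congr (1 + _).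
  apply: eq_bigr => m _; rewrite !euler_term_scale.
  have /eqP := euler_termS a m; rewrite mulrBr mulr1 subr_eq => /eqP e.
  by rewrite {1}e exprS; ring.
rewrite mulrDl mul1r; apply: (@cvgD _ C^o).
  by have := @cvg_euler_sum (a * q); rewrite -cvg_shiftS.
by apply: cvgM; [exact: cvg_cst | exact: cvg_euler_sum].
Qed.

Lemma euler_sum_iter a k :
  euler_sum a = qpoch q (- a * q) k * euler_sum (a * q ^+ k).
Proof.
elim: k => [|k IH]; first by rewrite qpoch0 mul1r expr0 mulr1.
rewrite IH euler_sumS qpochS -mulrA -exprSr mulrA; congr (_ * _).
by rewrite exprSr; ring.
Qed.

(** The term of index 0 is 1, and every later one carries a factor q^k, so the distance to 1 is at
    most |q|^k times the absolute sum [t]. *)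
Lemma cvg_euler_sum_scale a :
  (euler_sum (a * q ^+ k) : C^o) @[k --> \oo] --> (1 : C^o).
Proof.
have [M /absolutely_convergent[_ [t [_ _ le_t]]]] := euler_term_bounded a.
have qt : (`|q| ^+ k * t : C^o) @[k --> \oo] --> (0 : C^o).
  by rewrite -(mul0r t); apply: cvgM; [exact: cvg_norm_expr | exact: cvg_cst].
apply/cvgrPdist_lt => e e0.
have e20 : 0 < e / 2 by rewrite divr_gt0.
move/cvgrPdist_lt : qt => /(_ _ e20); apply: filterS => k.
have t0 : 0 <= t by have := le_t 0%N; rewrite big_geq.
rewrite sub0r normrN ger0_norm ?mulr_ge0 ?exprn_ge0 // => qt.
have := @cvg_euler_sum (a * q ^+ k); rewrite -cvg_shiftS.
move=> /cvgrPdist_lt/(_ _ e20)[n _ /(_ n (leqnn n))] /= dn.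
rewrite distrC.
rewrite -(subrK (\sum_(0 <= m < n.+1) euler_term (a * q ^+ k) m) (euler_sum _)).
rewrite -addrA [e]splitr; apply: le_lt_trans (ler_normD _ _) _.
apply: ltrD => //; apply: le_lt_trans qt.
rewrite big_nat_recl // euler_term0 addrAC subrr add0r.
apply: le_trans (ler_norm_sum _ _ _) _.
apply: (@le_trans _ _ (\sum_(0 <= m < n.+1) `|q| ^+ k * `|euler_term a m|)).
  rewrite [leRHS]big_nat_recl // -[leLHS]add0r lerD ?mulr_ge0 ?exprn_ge0 //.
  apply: ler_sum => m _.
  rewrite euler_term_scale normrM ler_wpM2r // -exprM normrX.
  by rewrite mulnS exprD ler_piMr ?exprn_ge0 // exprn_ile1 // ltW.
by rewrite -mulr_sumr ler_wpM2l // exprn_ge0.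
Qed.

(** By [euler_sum_iter] the finite product is the quotient of the sums at a and at a q^k, whose
    denominator tends to 1. *)
Lemma euler_identity a : euler_sum a = qpoch_inf q (- a * q).
Proof.
suff P_cvg : (qpoch q (- a * q) k : C^o) @[k --> \oo] --> (euler_sum a : C^o).
  by apply: esym; exact: cvg_lim P_cvg.
have := @cvg_euler_sum_scale a => s1.
have : (euler_sum a * (euler_sum (a * q ^+ k))^-1 : C^o) @[k --> \oo]
    --> (euler_sum a * 1^-1 : C^o).
  apply: cvgM; first exact: cvg_cst.
  by apply: cvgV; first exact: oner_neq0.
rewrite invr1 mulr1; apply: cvg_trans; apply: near_eq_cvg.
(* Within distance less than 1 of 1 the denominator is nonzero. *)
move/cvgrPdist_lt : s1 => /(_ _ ltr01); apply: filterS => k /= dk.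
rewrite {1}(euler_sum_iter a k) mulfK //; apply/eqP => s0.
by move: dk; rewrite s0 subr0 normr1 ltxx.
Qed.

End Euler.

(** * Summation over boxes and conclusion *)

Section Box.

(** Nested like the tuples themselves, so that a sum of products over it factors one index at a
    time. *)
Definition box n : seq (nat * nat * nat * nat) :=
  [seq (p, l) | p <- [seq (p, k) | p <- [seq (i, j) | i <- index_iota 0 n,
    j <- index_iota 0 n], k <- index_iota 0 n], l <- index_iota 0 n].

Lemma box_uniq n : uniq (box n).
Proof.
have u := iota_uniq 0 (n - 0).
by do 3![apply: allpairs_uniq => //; last by move=> [? ?] [? ?] _ _ [-> ->]].
Qed.

Lemma mem_box n i j k l :
  ((i, j, k, l) \in box n) = [&& i < n, j < n, k < n & l < n]%N.
Proof.
have pair_mem (S T : eqType) (s : seq S) (t : seq T) x y :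
    ((x, y) \in [seq (p, r) | p <- s, r <- t]) = (x \in s) && (y \in t).
  apply/allpairsP/andP => [[[p r] [/= ps rt [-> ->]]]|[xs yt]] //.
  by exists (x, y).
by rewrite !pair_mem !mem_index_iota -!andbA.
Qed.

Lemma box_sum (V : comNzRingType) (f g h e : nat -> V) n :
  \sum_(m <- box n) f m.1.1.1 * g m.1.1.2 * h m.1.2 * e m.2
  = (\sum_(0 <= m < n) f m) * (\sum_(0 <= m < n) g m)
    * (\sum_(0 <= m < n) h m) * (\sum_(0 <= m < n) e m).
Proof.
have pair_sum (S : Type) (s : seq S) (t : seq nat) (v : S -> V) (w : nat -> V) :
    \sum_(x <- [seq (p, r) | p <- s, r <- t]) v x.1 * w x.2
    = (\sum_(p <- s) v p) * (\sum_(r <- t) w r).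
  by rewrite big_allpairs mulr_suml; apply: eq_bigr => p _; rewrite mulr_sumr.
rewrite (pair_sum _ _ _ (fun p => f p.1.1 * g p.1.2 * h p.2)).
by rewrite (pair_sum _ _ _ (fun p => f p.1 * g p.2)) pair_sum.
Qed.

End Box.

Theorem mainTheorem2 (R : realType) (q A B C D : R[i]) (hq : `|q| < 1) :
  has_sum
    (fun m : nat * nat * nat * nat => let: (i, j, k, l) := m in
       A ^+ i * B ^+ j * C ^+ k * D ^+ l * inner_sum q i j k l)
    (qpoch_inf q (- A * q) * qpoch_inf q (- B * q)
     * qpoch_inf q (- C * q) * qpoch_inf q (- D * q)).
Proof.
pose u := euler_term q.
(* The closed form of the inner sums splits the family into four independent Euler terms. *)
have -> : (fun m : nat * nat * nat * nat => let: (i, j, k, l) := m in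
     A ^+ i * B ^+ j * C ^+ k * D ^+ l * inner_sum q i j k l)
  = (fun m => u A m.1.1.1 * u B m.1.1.2 * u C m.1.2 * u D m.2).
  apply/funext => -[[[i j] k] l] /=.
  by rewrite (inner_sumE _ _ _ _ (q_unity hq)) /u /euler_term; ring.
have norm_cvg a : exists t : R[i]^o,
    (\sum_(0 <= m < n) `|u a m| : R[i]^o) @[n --> \oo] --> t /\
    forall n, \sum_(0 <= m < n) `|u a m| <= t.
  have [M /absolutely_convergent[s [t [_ ut le_t]]]] := euler_term_bounded hq a.
  by exists t.
have [tA [uA le_A]] := norm_cvg A; have [tB [uB le_B]] := norm_cvg B.
have [tC [uC le_C]] := norm_cvg C; have [tD [uD le_D]] := norm_cvg D.
have norm_sum n : \sum_(m <- box n)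
    `|u A m.1.1.1 * u B m.1.1.2 * u C m.1.2 * u D m.2|
  = (\sum_(0 <= m < n) `|u A m|) * (\sum_(0 <= m < n) `|u B m|)
    * (\sum_(0 <= m < n) `|u C m|) * (\sum_(0 <= m < n) `|u D m|).
  by rewrite -box_sum; apply: eq_bigr => m _; rewrite !normrM.
(* The boxes exhaust all quadruples, and over a box both the sum and the absolute sum are products
   of four partial sums. *)
apply: (@has_sum_exhaustion _ _ _ _ (tA * tB * tC * tD) box).
- exact: box_uniq.
- move=> n [[[i j] k] l]; rewrite !mem_box => /and4P[? ? ? ?].
  by apply/and4P; split; apply: ltnW.
- move=> [[[i j] k] l]; exists (i + j + k + l).+1; rewrite mem_box.
  by apply/and4P; split; lia.
- under eq_fun do rewrite box_sum.
  rewrite -!(euler_identity hq).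
  have S a := @cvg_euler_sum R q hq a.
  exact: cvgM (cvgM (cvgM (S A) (S B)) (S C)) (S D).
- under eq_fun do rewrite norm_sum.
  exact: cvgM (cvgM (cvgM uA uB) uC) uD.
- move=> n; rewrite norm_sum.
  by do 3![apply: ler_pM => //; rewrite ?mulr_ge0 ?sumr_ge0 //].
Qed.
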